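(* Let $(E(t))_{t\ge 0}$ be a well posed nonlinear semigroup on a normed vector space $(X,\|\cdot\|)$, and let $(C_{\Delta t})_{\Delta t\ge 0}$ be a numerical method associated with it which is locally stable and consistent with the semigroup. Then the numerical method $(C_{\Delta t})$ is convergent to the nonlinear semigroup $(E(t))$.
   Context: Let $(X,\|\cdot\|)$ be a normed vector space. Nonlinear semigroup: a family of (not necessarily linear) mappings $E(t):X_t\to X$, $t\in[0,\infty)$, where the sets $X_t$ satisfy $X_{t+s}\subseteq X_t\subseteq X$ for all $t,s\in[0,\infty)$, $E(0)=\mathrm{id}_{X_0}$, and for all $t,s\in[0,\infty)$ one has $E(t)X_{t+s}\subseteq X_s$ and $E(t+s)u=E(s)E(t)u$ for every $u\in X_{t+s}$. Put $Z=\bigcup_{t\in[0,\infty)}\{t\}\times X_t\subseteq[0,\infty)\times X$. Well posed: the mapping $Z\ni(t,u)\mapsto E(t)u\in X$ is continuous. Numerical method associated with a well posed nonlinear semigroup: a continuous mapping $[0,\infty)\times X\ni(\Delta t,u)\mapsto C_{\Delta t}u\in X$ with $C_0=\mathrm{id}_X$. $C_{\Delta t}^n$ denotes the $n$-fold iterate of $C_{\Delta t}$. Regular subset: a subset $Z'\subseteq Z$ is regular if, writing $X'_t=\{u\in X_t : (t,u)\in Z'\}$ for $t\in[0,\infty)$, the following hold: $Z'$ is closed in $[0,\infty)\times X$; $E(t)X'_{t+s}\subseteq X'_s$ for all $t,s\in[0,\infty)$; $C_{\Delta t}X'_{t+\Delta t}\subseteq X'_t$ for all $t,\Delta t\in[0,\infty)$.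 Below, $X'_t$ always refers to the regular set $Z'$ under consideration. Locally stable: for every regular $Z'\subseteq Z$, $T\in(0,\infty)$ and compact $K\subseteq X$ there exist $L',\rho'>0$ such that for all $\Delta t>0$, $n\in\mathbb{N}$ and $u,v\in K\cap X'_{n\Delta t}$: if $n\Delta t\le T$ and $\|v-u\|\le\rho'$, then $\|C_{\Delta t}^n v-C_{\Delta t}^n u\|\le L'\|v-u\|$. Consistent (with the semigroup): for every regular $Z'\subseteq Z$, $T\in(0,\infty)$, compact $K\subseteq X$ and $\epsilon>0$ there exists $\delta>0$ such that for all $t\in[0,T]$, $\Delta t>0$ and $u\in K\cap X'_{t+\Delta t}$: if $\Delta t\le\delta$, then $\|C_{\Delta t}E(t)u-E(\Delta t)E(t)u\|\le\epsilon\,\Delta t$. Convergent (to the semigroup): for every regular $Z'\subseteq Z$, $T\in(0,\infty)$, compact $K\subseteq X$ and $\epsilon>0$ there exists $\theta>0$ such that for all $t\in[0,T]$, $\Delta t>0$, $n\in\mathbb{N}$ and $u\in K\cap X'_t\cap X'_{n\Delta t}$: if $\Delta t\le\theta$ and $|t-n\Delta t|\le\theta$, then $\|E(t)u-C_{\Delta t}^n u\|\le\epsilon$. *)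

(* Defs.v *)
From HB Require Import structures.
From mathcomp Require Import all_boot all_order all_algebra.
From mathcomp Require Import all_classical all_reals all_analysis.

Set Implicit Arguments.
Unset Strict Implicit.
Unset Printing Implicit Defensive.

Import Order.TTheory GRing.Theory Num.Theory.
Import numFieldNormedType.Exports.

Local Open Scope classical_set_scope.
Local Open Scope ring_scope.

(* A semigroup is a pair (D, E): D t is the domain X_t and the partial map
   E(t) : X_t -> X is represented by a total E t : X -> X whose values outside
   D t are never constrained.  Time ranges over [0, oo[: values of D, E and of
   the numerical method C at negative arguments are never constrained. *)

Section Defs.
Context {R : realType} {X : normedModType R}.
Implicit Types (D : R -> set X) (E C : R -> X -> X) (Z : set (R * X)).

Record nonlinear_semigroup D E : Prop := NonlinearSemigroup {
  semigroup_dom : forall (t s : R), 0 <= t -> 0 <= s -> D (t + s) `<=` D t ;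
  semigroup_id : forall u, D 0 u -> E 0 u = u ;
  semigroup_image : forall (t s : R), 0 <= t -> 0 <= s ->
    E t @` D (t + s) `<=` D s ;
  semigroup_add : forall (t s : R) (u : X), 0 <= t -> 0 <= s -> D (t + s) u ->
    E (t + s) u = E s (E t u) }.

(* The half space [0, oo[ * X. *)
Definition nonneg_time : set (R * X) := [set p | 0 <= p.1].

(* The set Z, i.e., the union over t >= 0 of {t} * X_t. *)
Definition semigroup_graph D : set (R * X) :=
  [set p | 0 <= p.1 /\ D p.1 p.2].

Definition well_posed D E : Prop :=
  {within semigroup_graph D, continuous (fun p : R * X => E p.1 p.2)}.

Record numerical_method C : Prop := NumericalMethod {
  method_continuous :
    {within nonneg_time, continuous (fun p : R * X => C p.1 p.2)} ;
  method_id : forall u, C 0 u = u }.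

(* The set X'_t. *)
Definition slice D Z' (t : R) : set X := [set u | D t u /\ Z' (t, u)].

Record regular D E C Z' : Prop := Regular {
  regular_sub : Z' `<=` semigroup_graph D ;
  (* closedness is relative to [0, oo[ * X *)
  regular_closed : closed (Z' : set (subspace nonneg_time)) ;
  regular_semigroup : forall (t s : R), 0 <= t -> 0 <= s ->
    E t @` slice D Z' (t + s) `<=` slice D Z' s ;
  regular_method : forall (t dt : R), 0 <= t -> 0 <= dt ->
    C dt @` slice D Z' (t + dt) `<=` slice D Z' t }.

Definition locally_stable D E C : Prop :=
  forall Z' (T : R) (K : set X), regular D E C Z' -> 0 < T -> compact K ->
  exists L rho : R, [/\ 0 < L, 0 < rho &
    forall (dt : R) (n : nat) (u v : X), 0 < dt ->
      (K `&` slice D Z' (n%:R * dt)) u -> (K `&` slice D Z' (n%:R * dt)) v ->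
      n%:R * dt <= T -> `|v - u| <= rho ->
      `|iter n (C dt) v - iter n (C dt) u| <= L * `|v - u|].

Definition consistent D E C : Prop :=
  forall Z' (T : R) (K : set X) (eps : R),
  regular D E C Z' -> 0 < T -> compact K -> 0 < eps ->
  exists2 delta : R, 0 < delta &
    forall (t dt : R) (u : X), 0 <= t <= T -> 0 < dt ->
      (K `&` slice D Z' (t + dt)) u -> dt <= delta ->
      `|C dt (E t u) - E dt (E t u)| <= eps * dt.

Definition convergent D E C : Prop :=
  forall Z' (T : R) (K : set X) (eps : R),
  regular D E C Z' -> 0 < T -> compact K -> 0 < eps ->
  exists2 theta : R, 0 < theta &
    forall (t dt : R) (n : nat) (u : X), 0 <= t <= T -> 0 < dt ->
      (K `&` slice D Z' t `&` slice D Z' (n%:R * dt)) u ->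
      dt <= theta -> `|t - n%:R * dt| <= theta ->
      `|E t u - iter n (C dt) u| <= eps.

End Defs.

(* Main.v *)
Require Import Defs.
From HB Require Import structures.
From mathcomp Require Import all_boot all_order all_algebra.
From mathcomp Require Import all_classical all_reals all_analysis.
From mathcomp Require Import ring lra.

Set Implicit Arguments.
Unset Strict Implicit.
Unset Printing Implicit Defensive.

Import Order.TTheory GRing.Theory Num.Theory.
Import numFieldNormedType.Exports.

Local Open Scope classical_set_scope.
Local Open Scope ring_scope.

(** Convergence is the classical argument that stability and consistency
imply convergence, made local by compactness.  Write w_j = E(j dt) u for the
exact solution on the time grid.  The error at time n dt telescopes
(telescoping_iter):

    C^n u - E(n dt) u
      = sum over j < n of  C^(n-j-1) (C w_j) - C^(n-j-1) (w_(j+1)).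

The inner difference C w_j - w_(j+1) = C E(j dt) u - E(dt) E(j dt) u is at most
e dt by consistency, and stability propagates it with a factor L that does not
depend on j, n or dt.  The n terms add up to at most L e (n dt), which is small
because n dt is bounded (grid_convergence).  The passage from the grid time n dt
to a nearby time t is uniform continuity of E on a compact set of pairs (t, u)
(compact_unif_continuous).

Two points need care.

Stability may only be used between points of one fixed compact set.  The exact
solutions starting in K fill a compact set K1, the image under E of a compact
part of the graph; and one step of the method with dt <= 1 maps K1 into the
image K2 of [0, 1] * K1 under C, again compact.  Since C_0 is the identity, K2
contains K1, so it contains both C w_j and w_(j+1).

Consistency at time j dt asks that u belong to the slice X'_((j+1) dt), whereas
u is only known to lie in X'_t and X'_(n dt): the slices of a regular set need
not decrease with time.  The remedy is to replace Z' by the set of all (t, u)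
such that (r, u) is in Z' for some r in [t, T + 1] (earlier_times).  Its slices
do decrease, and it is again regular (regular_earlier_times): invariance under E
and C is a shift of r, and closedness holds because projecting a closed set
along the compact interval [0, T + 1] gives a closed set
(closed_compact_projection). *)

(** * Compactness *)

(** The tube lemma: if u is outside the projection, every point of A * {u} has a
neighbourhood avoiding S, and by compactness a single neighbourhood of u works
for all of A. *)
Lemma closed_compact_projection (T U : topologicalType) (A : set T)
    (S : set (T * U)) :
  compact A -> closed S -> closed [set u | exists2 a, A a & S (a, u)].
Proof.
move=> /compact_near_coveringP cA cS; rewrite -openC openE => u nSu.
have nearA a : A a -> \forall b \near a & v \near u, ~ S (b, v).
  move=> Aa; have : nbhs (a, u) (~` S).
    apply: open_nbhs_nbhs; split; first exact: closed_openC.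
    by move=> Sau; apply: nSu; exists a.
  by apply: filterS => -[].
have := cA U (nbhs u) (fun v a => ~ S (a, v)) (nbhs_filter u) nearA.
by apply: filterS => v Vv [a Aa]; exact: Vv.
Qed.

(** The Heine-Cantor theorem for a function that is continuous only relatively
to the compact set; around each point of K half the radius of relative
continuity is a valid modulus, and compactness makes the modulus uniform. *)
Lemma compact_unif_continuous (R : realType) (T : pseudoMetricType R)
    (V : normedModType R) (K : set T) (f : T -> V) (e : R) :
  compact K -> {within K, continuous f} -> 0 < e ->
  exists2 d : R, 0 < d & forall x y, K x -> K y -> ball x d y ->
    `|f x - f y| <= e.
Proof.
move=> /compact_near_coveringP/near_covering_withinP cK
  /subspace_continuousP cf e0.
have near_K x : K x -> \forall x' \near x & d \near 0^'+, K x' ->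
    forall y, K y -> ball x' d y -> `|f x' - f y| <= e.
  move=> Kx; have e20 : 0 < e / 2 by rewrite divr_gt0.
  have /cvgrPdist_lt /(_ _ e20) := cf x Kx.
  rewrite /= near_withinE => /nbhs_ballP[r /= r0 rK].
  have r20 : 0 < r / 2 by rewrite divr_gt0.
  exists (ball x (r / 2), [set d : R | d < r / 2]) => /=.
    by split; [exact: nbhsx_ballx|exact: nbhs_right_lt].
  move=> [y d] [/= xy dr] Ky z Kz yz.
  have fxy : `|f x - f y| < e / 2.
    by apply: rK => //; apply: le_ball xy; lra.
  have fxz : `|f x - f z| < e / 2.
    apply: rK => //; rewrite (splitr r); apply: ball_triangle xy _.
    exact: le_ball (ltW dr) _ yz.
  have -> : f y - f z = (f x - f z) - (f x - f y).
    by rewrite opprB [RHS]addrC subrKA.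
  by rewrite (le_trans (ler_normB _ _))// (splitr e) lerD// ltW.
have near_d := cK R 0^'+ (fun d x => forall y, K y -> ball x d y ->
  `|f x - f y| <= e) (at_right_proper_filter _) near_K.
near (0 : R)^'+ => d; exists d => // x y Kx.
by move: x Kx y; near: d; exact: near_d.
Unshelve. all: by end_near. Qed.

(** * Telescoping *)

(** Lady Windermere's fan: the hybrid that follows w up to index m and then
applies F for the remaining n - m steps is F^n (w_0) for m = 0 and w_n for
m = n, and consecutive hybrids differ by one step, propagated by F. *)
Lemma telescoping_iter (R : realType) (V : normedModType R) (F : V -> V)
    (w : nat -> V) (n : nat) (a : R) :
  (forall j, (j < n)%N ->
    `|iter (n - j.+1) F (F (w j)) - iter (n - j.+1) F (w j.+1)| <= a) ->
  `|iter n F (w 0) - w n| <= n%:R * a.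
Proof.
move=> step.
suff fan m : (m <= n)%N ->
    `|iter n F (w 0) - iter (n - m) F (w m)| <= m%:R * a.
  by have := fan n (leqnn n); rewrite subnn.
elim: m => [|m IH] mn; first by rewrite subn0 subrr normr0 mul0r.
rewrite -(subrKA (iter (n - m) F (w m))) (le_trans (ler_normD _ _))//.
rewrite -natr1 mulrDl mul1r lerD ?IH 1?ltnW//.
by rewrite -[in X in iter X _ (w m)](subnSK mn) iterSr; exact: step.
Qed.

(** * Regular sets *)

Section Convergence.
Context {R : realType} {X : normedModType R}.
Context {D : R -> set X} {E C : R -> X -> X}.

Lemma regular_slice Z' t u : regular D E C Z' -> Z' (t, u) -> slice D Z' t u.
Proof. by move=> rZ Ztu; split=> //; have [] := regular_sub rZ Ztu. Qed.

(** The half space [0, oo[ * X is itself closed, so a relatively closed subset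
is closed in the whole product. *)
Lemma regular_closed_prod Z' : regular D E C Z' -> closed Z'.
Proof.
move=> rZ; have cT : closed (nonneg_time : set (R * X)).
  by apply: preimage_closed (@closed_ge R 0) => p _; exact: cvg_fst.
have := regular_closed rZ; rewrite -closed_setSI//.
by rewrite setIidr// => p /(regular_sub rZ)[].
Qed.

(** The upper bound S on r keeps the projection along r compact; with r merely
at least t, the set could fail to be closed. *)
Definition earlier_times (S : R) (Z' : set (R * X)) : set (R * X) :=
  [set p | 0 <= p.1 /\ exists2 r, p.1 <= r <= S & Z' (r, p.2)].

(** If (r, u) witnesses membership of (t + s, u), then (r - t, E(t) u) witnesses
membership of (s, E(t) u), and likewise for C. *)
Lemma regular_earlier_times S Z' : nonlinear_semigroup D E ->
  regular D E C Z' -> regular D E C (earlier_times S Z').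
Proof.
move=> hE rZ.
have sub : earlier_times S Z' `<=` semigroup_graph D.
  move=> [t u] [/= t0 [r /andP[tr _] /(regular_sub rZ)[/= _ Dru]]].
  split=> //=; apply: (semigroup_dom hE (s := r - t)) => //.
    by rewrite subr_ge0.
  by rewrite addrC subrK.
have subZ t s r u : 0 <= t -> 0 <= s -> t + s <= r -> Z' (r, u) ->
    slice D Z' (t + (r - t)) u /\ slice D Z' (r - t + t) u.
  by move=> t0 s0 tsr Zru; split; rewrite ?subrK ?[t + _]addrC ?subrK;
    exact: regular_slice.
split=> //.
- apply: closed_subspaceW.
  (* t <= r is written 0 <= r - t to be the preimage of a closed half line *)
  have -> : earlier_times S Z' = [set p | exists2 r, `[0, S]%classic r &
      [set q : R * (R * X) | [/\ 0 <= q.2.1, 0 <= q.1 - q.2.1 &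
        Z' (q.1, q.2.2)]] (r, p)].
    apply/seteqP; split=> [[t u] /= [t0 [r /andP[tr rS] Zru]]|[t u] /=].
      exists r; last by rewrite subr_ge0.
      by rewrite in_itv/= rS (le_trans t0 tr).
    move=> [r]; rewrite in_itv/= subr_ge0 => /andP[_ rS] [t0 tr Zru].
    by split=> //; exists r; rewrite ?tr.
  apply: closed_compact_projection; first exact: segment_compact.
  have -> : [set q : R * (R * X) | [/\ 0 <= q.2.1, 0 <= q.1 - q.2.1 &
        Z' (q.1, q.2.2)]] =
      (fun q : R * (R * X) => q.2.1) @^-1` [set x | 0 <= x] `&`
      ((fun q : R * (R * X) => q.1 - q.2.1) @^-1` [set x | 0 <= x] `&`
       (fun q : R * (R * X) => (q.1, q.2.2)) @^-1` Z').
    by apply/seteqP; split=> q /=; [case|case=> ? []].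
  have c1 : continuous (fun q : R * (R * X) => q.1) by move=> q; exact: cvg_fst.
  have c21 : continuous (fun q : R * (R * X) => q.2.1).
    by move=> q; apply: (continuous_comp (f := snd) (g := fst));
      [exact: cvg_snd|exact: cvg_fst].
  have c22 : continuous (fun q : R * (R * X) => q.2.2).
    by move=> q; apply: (continuous_comp (f := snd) (g := snd));
      [exact: cvg_snd|exact: cvg_snd].
  apply: closedI.
    by apply: preimage_closed (@closed_ge R 0) => q _; exact: c21.
  apply: closedI.
    apply: preimage_closed (@closed_ge R 0) => q _.
    by apply: cvgB; [exact: c1|exact: c21].
  apply: preimage_closed (regular_closed_prod rZ) => q _.
  exact: cvg_pair (c1 q) (c22 q).
- move=> t s t0 s0 _ [u [_ [/= _ [r /andP[tsr rS] Zru]]] <-].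
  have ZE : earlier_times S Z' (s, E t u).
    split=> //; exists (r - t); first by apply/andP; split => /=; lra.
    have rt0 : 0 <= r - t by lra.
    apply: (regular_semigroup rZ t0 rt0 _).2.
    by exists u => //; exact: (subZ _ _ _ _ t0 s0 tsr Zru).1.
  by split=> //; have [] := sub _ ZE.
- move=> t dt t0 dt0 _ [u [_ [/= _ [r /andP[tsr rS] Zru]]] <-].
  have ZC : earlier_times S Z' (t, C dt u).
    split=> //; exists (r - dt); first by apply/andP; split => /=; lra.
    have rt0 : 0 <= r - dt by lra.
    apply: (regular_method rZ rt0 dt0 _).2.
    by exists u => //; apply: (subZ dt t r u _ _ _ Zru).2; lra.
  by split=> //; have [] := sub _ ZC.
Qed.

Lemma compact_regular Z' S (K : set X) : regular D E C Z' -> compact K ->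
  compact (`[0, S]%classic `*` K `&` Z').
Proof.
move=> rZ cK; apply: compact_closedI (regular_closed_prod rZ).
by apply: compact_setX => //; exact: segment_compact.
Qed.

Lemma regular_well_posed Z' (A : set (R * X)) : well_posed D E ->
  regular D E C Z' -> {within A `&` Z', continuous (fun p => E p.1 p.2)}.
Proof.
move=> hwp rZ; apply: continuous_subspaceW hwp.
by move=> p [_] /(regular_sub rZ).
Qed.

(** * Convergence *)

(** The error estimate at grid times, for a regular set whose slices decrease:
this monotonicity places u in X'_((j+1) dt) for every j < n, as consistency
requires. *)
Lemma grid_convergence Z' (S eps : R) (K : set X) :
  nonlinear_semigroup D E -> well_posed D E -> numerical_method C ->
  locally_stable D E C -> consistent D E C -> regular D E C Z' ->
  (forall (t s : R) u, 0 <= t <= s -> Z' (s, u) -> Z' (t, u)) ->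
  0 < S -> compact K -> 0 < eps ->
  exists2 theta : R, 0 < theta &
    forall (dt : R) (n : nat) u, 0 < dt -> dt <= theta -> n%:R * dt <= S ->
      K u -> Z' (n%:R * dt, u) ->
      `|E (n%:R * dt) u - iter n (C dt) u| <= eps.
Proof.
move=> hE hwp hC hstab hcons rZ Zdecr S0 cK eps0.
pose K1 := (fun p => E p.1 p.2) @` (`[0, S]%classic `*` K `&` Z').
pose K2 := (fun p => C p.1 p.2) @` (`[0, 1]%classic `*` K1).
have cK1 : compact K1.
  apply: continuous_compact; last exact: compact_regular.
  exact: regular_well_posed.
have cK2 : compact K2.
  apply: continuous_compact.
    apply: continuous_subspaceW (method_continuous hC) => -[t u] [/= + _].
    by rewrite in_itv => /andP[].
  by apply: compact_setX => //; exact: segment_compact.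
have [L [rho [L0 rho0 stab]]] := hstab Z' S K2 rZ S0 cK2.
(* e <= rho makes the one-step error e dt, with dt <= 1, admissible in the
   stability estimate; e <= eps / (L S) makes the sum of the errors at most
   L e S <= eps *)
pose e := Num.min rho (eps / (L * S)).
have LS0 : 0 < L * S by rewrite mulr_gt0.
have e0 : 0 < e by rewrite lt_min rho0 divr_gt0.
have [delta delta0 cons] := hcons Z' S K e rZ S0 cK e0.
exists (Num.min delta 1); first by rewrite lt_min delta0 ltr01.
move=> dt n u dt0; rewrite le_min => /andP[dt_delta dt1] nS Ku Zu.
have grid0 m : 0 <= m%:R * dt by rewrite mulr_ge0// ltW.
have gridS m : (m <= n)%N -> m%:R * dt <= S.
  by move=> mn; apply: le_trans nS; rewrite ler_pM2r// ler_nat.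
have Zu_le m : (m <= n)%N -> Z' (m%:R * dt, u).
  by move=> mn; apply: Zdecr Zu; rewrite grid0 ler_pM2r// ler_nat.
(* after time m dt, the exact solution still has n - m steps to live *)
have ZE m : (m <= n)%N -> slice D Z' ((n - m)%:R * dt) (E (m%:R * dt) u).
  move=> mn; apply: (regular_semigroup rZ (grid0 m) (grid0 _)).
  exists u => //; rewrite -mulrDl -natrD subnKC//; exact: regular_slice.
have K1E m : (m <= n)%N -> K1 (E (m%:R * dt) u).
  move=> mn; exists (m%:R * dt, u) => //; split; last exact: Zu_le.
  by split=> //=; rewrite in_itv/= grid0 gridS.
have w0 : E (0%:R * dt) u = u.
  have [_ /=] := regular_sub rZ (Zu_le 0 isT).
  by rewrite mul0r; exact: semigroup_id.
have fan : `|iter n (C dt) (E (0%:R * dt) u) - E (n%:R * dt) u| <=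
    n%:R * (L * (e * dt)).
  apply: (telescoping_iter (w := fun j => E (j%:R * dt) u)) => j jn.
  have jn' := ltnW jn.
  have gridDS : j.+1%:R * dt = j%:R * dt + dt by rewrite -natr1 mulrDl mul1r.
  have localE : `|C dt (E (j%:R * dt) u) - E (j.+1%:R * dt) u| <= e * dt.
    rewrite gridDS (semigroup_add hE (grid0 j) (ltW dt0)).
      apply: cons => //; first by rewrite grid0 gridS.
      by split=> //; rewrite -gridDS; apply: regular_slice => //; exact: Zu_le.
    by rewrite -gridDS; have [] := regular_sub rZ (Zu_le _ jn).
  apply: le_trans (_ : L * `|C dt (E (j%:R * dt) u) - E (j.+1%:R * dt) u| <= _);
    last by rewrite ler_pM2l.
  apply: stab => //.
  - split; last exact: ZE.
    (* K1 is contained in K2 because C_0 is the identity *)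
    exists (0, E (j.+1%:R * dt) u); last exact: (method_id hC).
    by split; [rewrite /= in_itv/= lexx ler01|exact: K1E].
  - split.
      exists (dt, E (j%:R * dt) u) => //.
      by split; [rewrite /= in_itv/= ltW|exact: K1E].
    apply: (regular_method rZ (grid0 _) (ltW dt0)).
    exists (E (j%:R * dt) u) => //.
    have -> : (n - j.+1)%:R * dt + dt = (n - j)%:R * dt.
      by rewrite -(subnSK jn) -natr1 mulrDl mul1r.
    exact: ZE.
  - exact: gridS (leq_subr _ _).
  - rewrite (le_trans localE)// (le_trans (_ : _ <= e)) ?ge_min ?lexx//.
    by rewrite ger_pMr.
rewrite distrC -[in X in iter n _ X]w0 (le_trans fan)//.
have -> : n%:R * (L * (e * dt)) = e * (L * (n%:R * dt)) by ring.
apply: le_trans (_ : e * (L * S) <= _); first by rewrite !ler_pM2l.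
by rewrite -ler_pdivlMr// ge_min lexx orbT.
Qed.

End Convergence.

Theorem theorem3p2 (R : realType) (X : normedModType R)
    (D : R -> set X) (E C : R -> X -> X)
    (hE : nonlinear_semigroup D E) (hwp : well_posed D E)
    (hC : numerical_method C)
    (hstab : locally_stable D E C) (hcons : consistent D E C) :
  convergent D E C.
Proof.
move=> Z' T K eps rZ T0 cK eps0.
have eps20 : 0 < eps / 2 by rewrite divr_gt0.
have S0 : 0 < T + 1 by rewrite addr_gt0.
have [d d0 unif] := compact_unif_continuous (compact_regular (S := T + 1) rZ cK)
  (regular_well_posed hwp rZ) eps20.
have rZS := regular_earlier_times (T + 1) hE rZ.
have ZS_decr (t s : R) u : 0 <= t <= s ->
    earlier_times (T + 1) Z' (s, u) -> earlier_times (T + 1) Z' (t, u).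
  move=> /andP[t0 ts] [/= s0 [r /andP[sr rS] Zru]]; split=> //.
  by exists r => //=; rewrite rS (le_trans ts sr).
have [h h0 grid] := grid_convergence hE hwp hC hstab hcons rZS ZS_decr S0 cK
  eps20.
(* h controls the error on the grid; d / 2 gives the strict |t - n dt| < d that
   uniform continuity needs; 1 keeps n dt below T + 1 *)
exists (Num.min (Num.min h (d / 2)) 1).
  by rewrite !lt_min h0 ltr01 divr_gt0.
move=> t dt n u /andP[t0 tT] dt0 [[Ku [_ Ztu]] [_ Znu]].
rewrite !le_min => /andP[/andP[dth _] _] /andP[/andP[_ tnd] tn1].
have n0 : 0 <= n%:R * dt by rewrite mulr_ge0// ltW.
have nS : n%:R * dt <= T + 1 by move: tn1; rewrite ler_norml => /andP[]; lra.
rewrite -(subrKA (E (n%:R * dt) u)) (le_trans (ler_normD _ _))//.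
rewrite (splitr eps) lerD//.
  apply: (unif (t, u) (n%:R * dt, u)).
  - by split=> //; split=> //=; rewrite in_itv/= t0/=; lra.
  - by split=> //; split=> //=; rewrite in_itv/= n0.
  - split=> /=; last exact: ballxx.
    by rewrite /ball/= (le_lt_trans tnd)// ltr_pdivrMr// ltr_pMr// ltr1n.
apply: grid => //; split=> //=.
by exists (n%:R * dt) => //; rewrite lexx nS.
Qed.
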